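(* Let $(\Omega,\mathcal{F},\mu)$ be a measure space, $1\le p<\infty$, and $s\in L^p(\Omega;\mathbb{S}^N)$. Let $\mathfrak{S}\subset\mathbb{S}^N$ be a nonempty finite set and let $\|\cdot\|_F$ denote the Frobenius norm. Then there exists at least one measurable function $\tilde s^*:\Omega\to\mathfrak{S}$ such that for $\mu$-almost every $\omega\in\Omega$, $$\tilde s^*(\omega)\in\arg\min_{\mathfrak{s}\in\mathfrak{S}}\|s(\omega)-\mathfrak{s}\|_F .$$ Moreover, if the tie-set $$\Omega_T:=\bigcup_{\substack{\mathfrak{s}_i,\mathfrak{s}_j\in\mathfrak{S}\\ \mathfrak{s}_i\ne\mathfrak{s}_j}}\{\omega\in\Omega:\|s(\omega)-\mathfrak{s}_i\|_F=\|s(\omega)-\mathfrak{s}_j\|_F\}$$ satisfies $\mu(\Omega_T)=0$, then $\tilde s^*$ is unique $\mu$-almost everywhere.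
   Context: $N\ge 2$ is an integer and $\mathbb{S}^N$ is the space of real symmetric $N\times N$ matrices, with its Borel $\sigma$-algebra. *)

(* Defs.v *)
From HB Require Import structures.
From mathcomp Require Import all_boot all_order all_algebra.
From mathcomp Require Import all_classical all_reals all_analysis.

Set Implicit Arguments.
Unset Strict Implicit.
Unset Printing Implicit Defensive.

Import Order.TTheory GRing.Theory Num.Theory.
Import numFieldNormedType.Exports.

Local Open Scope classical_set_scope.
Local Open Scope ring_scope.

Section SymmetricMatrices.
Context (R : realType) (N : nat).

Definition symmx_set : set 'M[R]_N := [set A | A \is symmetricmx].

(* The topology of [symmx] is the subset topology inherited from ['M[R]_N],
   whose (entrywise) topology is the one induced by any norm. *)
Definition symmx : Type := set_type symmx_set.

HB.instance Definition _ := Topological.copy symmx (set_type symmx_set).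

Definition mx_of_symmx (A : symmx) : 'M[R]_N := set_val A.

Lemma symmx_set0 : symmx_set 0.
Proof. by apply/is_hermitianmxP; rewrite trmx0 map_mx0 scaler0. Qed.

Definition symmx0 : symmx := SigSub (mem_set symmx_set0).

HB.instance Definition _ := isPointed.Build symmx symmx0.

(* [symmx] carries its Borel sigma-algebra. *)
HB.instance Definition _ :=
  Measurable.copy symmx (g_sigma_algebraType (@open symmx)).

End SymmetricMatrices.

Coercion mx_of_symmx : symmx >-> matrix.

Definition frobenius_norm (R : realType) (m n : nat) (A : 'M[R]_(m, n)) : R :=
  Num.sqrt (\sum_i \sum_j A i j ^+ 2).

Definition frobenius_dist (R : realType) (m n : nat) (A B : 'M[R]_(m, n)) : R :=
  frobenius_norm (A - B).

Definition argmin (X : Type) (R : realType) (D : set X) (f : X -> R) : set X :=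
  [set x | D x /\ forall y, D y -> f x <= f y].

Section Selections.
Context (d : measure_display) (T : measurableType d) (R : realType) (N : nat).
Implicit Types (mu : {measure set T -> \bar R}) (s t : T -> symmx R N)
  (S : set (symmx R N)).

(* [s] is an everywhere-defined representative of a class in L^p. *)
Definition in_Lp mu (p : R) s : Prop :=
  measurable_fun setT s /\
  finite_norm mu p%:E (fun w => frobenius_norm (s w)).

Definition measurable_into S t : Prop :=
  measurable_fun setT t /\ forall w, S (t w).

Definition ae_nearest mu s S t : Prop :=
  {ae mu, forall w,
    argmin S (fun a : symmx R N => frobenius_dist (s w) a) (t w)}.

Definition tie_set s S : set T :=
  \bigcup_(ab in [set ab : symmx R N * symmx R N |
                   [/\ S ab.1, S ab.2 & ab.1 <> ab.2]])
    [set w | frobenius_dist (s w) ab.1 = frobenius_dist (s w) ab.2].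

End Selections.

(* Main.v *)
(** Running through the finitely many candidates and switching to the next one
    whenever it is at least as close gives a measurable nearest selection,
    because the switch happens on a measurable set.  At a point where two
    nearest selections differ, both values are at the same minimal distance,
    so the point is in the tie set. *)

Require Import Defs.
From mathcomp Require Import all_boot all_order all_algebra.
From mathcomp Require Import all_classical all_reals all_analysis.
From mathcomp Require Import measurable_realfun.
Import Order.TTheory GRing.Theory Num.Theory.
Import numFieldNormedType.Exports.
Local Open Scope classical_set_scope.
Local Open Scope ring_scope.

Lemma continuous_mx_of_symmx (R : realType) (N : nat) :
  continuous (@mx_of_symmx R N).
Proof. exact: initial_continuous. Qed.

(** Entries are continuous, so preimages of the open rays generating the Borel sets of [R] are open,
    and open sets generate the sigma-algebra of [symmx R N]. *)
Lemma measurable_symmx_entry (R : realType) (N : nat) (i j : 'I_N) :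
  measurable_fun setT (fun A : symmx R N => (A : 'M[R]_N) i j).
Proof.
apply: (measurability _ (RGenOInfty.measurableE R)).
move=> _ [_ [a ->] <-]; rewrite setTI.
apply: (@sub_sigma_algebra _ setT (@open (symmx R N))).
have cij : continuous (fun A : symmx R N => (A : 'M[R]_N) i j).
  move=> A; apply: (@continuous_comp _ _ _ (@mx_of_symmx R N) (fun B => B i j)).
    exact: continuous_mx_of_symmx.
  exact: coord_continuous.
by move/continuousP : cij; apply; exact: interval_open.
Qed.

Lemma measurable_frobenius_dist (R : realType) (N : nat) (B : 'M[R]_N) :
  measurable_fun setT (fun A : symmx R N => frobenius_dist A B).
Proof.
apply: (measurableT_comp (continuous_measurable_fun (@sqrt_continuous R))).
apply: measurable_sum => i; apply: measurable_sum => j.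
apply: measurable_funX; under eq_fun do rewrite !mxE.
by apply: measurable_funB => //; exact: measurable_symmx_entry.
Qed.

Lemma measurable_argmin_selection (d d' : measure_display)
    (T : measurableType d) (X : measurableType d') (R : realType)
    (D : set X) (f : X -> T -> R) :
  D !=set0 -> finite_set D -> (forall x, measurable_fun setT (f x)) ->
  exists t : T -> X, measurable_fun setT t /\ forall w, argmin D (f^~ w) (t w).
Proof.
move=> D0 /finite_seqP[l Dl] mf; rewrite {}Dl in D0 *.
case: l D0 => [[//]|x l _].
(* The induction also carries measurability of the attained value [f (t w) w]: [f] is measurable in
   [w] only for each fixed candidate, so this does not follow from measurability of [t]. *)
suff [t [mt _ tmin]] : exists t : T -> X, [/\ measurable_fun setT t,
    measurable_fun setT (fun w => f (t w) w) &
    forall w, argmin [set` x :: l] (f^~ w) (t w)] by exists t.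
(* The head [x] stays fixed, so the base case is the singleton; a new candidate [y] enters just
   behind it. *)
elim: l => [|y l [t [mt mft tmin]]].
  exists (cst x); split => //; first exact: mf.
  by move=> w; split=> [|z]; rewrite /= inE // => /eqP ->.
have mle : measurable_fun setT (fun w => f y w <= f (t w) w).
  exact: measurable_fun_ler.
exists (fun w => if f y w <= f (t w) w then y else t w); split.
- exact: measurable_fun_ifT.
- rewrite (_ : (fun w => _) =
      fun w => if f y w <= f (t w) w then f y w else f (t w) w).
    exact: measurable_fun_ifT.
  by apply/funext => w; case: ifP.
- move=> w; have [/= tl tle] := tmin w; split.
    case: ifP => _ /=; rewrite !inE ?eqxx ?orbT //.
    by move: tl; rewrite inE => /orP[|] ->; rewrite ?orbT.
  (* [orbCA] brings the case [z = y] to the front, leaving membership in the old list [x :: l]. *)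
  move=> z /=; rewrite !inE orbCA => /orP[/eqP ->|zl].
    by case: (leP (f y w) (f (t w) w)) => // /ltW.
  have /tle {}tle : z \in x :: l by rewrite inE.
  by case: (leP (f y w) (f (t w) w)) => // fy; exact: le_trans tle.
Qed.

(** A finite union, over pairs of candidates, of sets where two measurable functions agree. Hence a
    tie set of measure zero is its own measurable null cover. *)
Lemma measurable_tie_set (d : measure_display) (T : measurableType d)
    (R : realType) (N : nat) (s : T -> symmx R N) (S : set (symmx R N)) :
  measurable_fun setT s -> finite_set S -> measurable (tie_set s S).
Proof.
move=> ms Sfin; apply: fin_bigcup_measurable => [|ab _].
  apply: (sub_finite_set _ (finite_setX Sfin Sfin)).
  by move=> ab [].
have mdist (B : 'M[R]_N) : measurable_fun setT (fun w => frobenius_dist (s w) B).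
  exact: measurableT_comp (measurable_frobenius_dist _ _ B) ms.
have := measurable_fun_eqr (mdist ab.1) (mdist ab.2).
move=> /(_ measurableT [set true] I); rewrite setTI; congr measurable.
by apply/seteqP; split => w /= /eqP.
Qed.

Lemma argmin_tie_set (d : measure_display) (T : measurableType d)
    (R : realType) (N : nat)
    (s : T -> symmx R N) (S : set (symmx R N)) (w : T) (a b : symmx R N) :
  argmin S (fun c : symmx R N => frobenius_dist (s w) c) a ->
  argmin S (fun c : symmx R N => frobenius_dist (s w) c) b ->
  a <> b -> tie_set s S w.
Proof.
move=> [Sa amin] [Sb bmin] ab; exists (a, b) => //=.
(* Each of [a] and [b] competes against the other, giving both inequalities. *)
by apply/le_anti; rewrite amin //= bmin.
Qed.

Theorem theorem8 (R : realType) (N : nat) (hN : (2 <= N)%N)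
    (d : measure_display) (Omega : measurableType d)
    (mu : {measure set Omega -> \bar R})
    (p : R) (hp : 1 <= p)
    (s : Omega -> symmx R N) (hs : in_Lp mu p s)
    (S : set (symmx R N)) (hS0 : S !=set0) (hSfin : finite_set S) :
  (exists t : Omega -> symmx R N, measurable_into S t /\ ae_nearest mu s S t) /\
  (mu (tie_set s S) = 0%E ->
   forall t1 t2 : Omega -> symmx R N,
     measurable_into S t1 -> ae_nearest mu s S t1 ->
     measurable_into S t2 -> ae_nearest mu s S t2 ->
     {ae mu, forall w, t1 w = t2 w}).
Proof.
have [ms _] := hs; split.
  have [|t [mt tmin]] := @measurable_argmin_selection _ _ _ _ R S
    (fun (a : symmx R N) w => frobenius_dist (s w) a) hS0 hSfin.
    by move=> a; exact: measurableT_comp (measurable_frobenius_dist _ _ _) ms.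
  exists t; split; first by split=> // w; case: (tmin w).
  exact: aeW.
move=> tie0 t1 t2 _ min1 _ min2.
have tieN : mu.-negligible (tie_set s S).
  by exists (tie_set s S); split => //; exact: measurable_tie_set.
(* The set where [t1] and [t2] differ is covered by three null sets: the tie set and the sets where
   [t1] or [t2] fails to be nearest. *)
apply: negligibleS (negligibleU tieN (negligibleU min1 min2)) => w /= t12.
have [n1|/contrapT a1] := pselect (~ argmin S
  (fun a : symmx R N => frobenius_dist (s w) a) (t1 w)); first by right; left.
have [n2|/contrapT a2] := pselect (~ argmin S
  (fun a : symmx R N => frobenius_dist (s w) a) (t2 w)); first by right; right.
by left; exact: argmin_tie_set a1 a2 t12.
Qed.
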